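(* Let $m\ge 1$ and $t\geq m+1$ be integers, and let $w\in\tilde{\mathbf{A}}^{(-t/m,m)}_0$ strictly. Put $v_n=w(n)$, $n=1,2,\ldots$, and suppose that the infinite product $\prod^\infty_{n=1}(1+v_n)$ is convergent, with value $S$. Let $A_0=0$, $A_n=\prod^n_{k=1}(1+v_k)$ for $n=1,2,\ldots$, and $a_n=A_n-A_{n-1}$ for $n=1,2,\ldots$. Then there exists a function $g\in\tilde{\mathbf{A}}^{(0,m)}_0$ strictly such that $$A_{n-1}=S+n\,a_n\,g(n)\quad\text{for all sufficiently large integers } n.$$ Therefore, we also have $$A_n-S\sim \alpha\, n^{1-t/m}\quad\text{as } n\to\infty,\quad\text{for some constant }\alpha\neq 0.$$
   Context: Functions and sequences may be complex-valued. For a positive integer $m$ and a (in general complex) number $\gamma$, a function $f(x)$ defined for all large $x$ is said to be in the set $\tilde{\mathbf{A}}^{(\gamma,m)}_0$ if it has a Poincaré-type asymptotic expansion of the form $$f(x)\sim\sum_{i=0}^\infty f_i\,x^{\gamma-i/m}\quad\text{as } x\to\infty,$$ that is, for every integer $N\ge 1$, $f(x)-\sum_{i=0}^{N-1}f_i x^{\gamma-i/m}=O(x^{\gamma-N/m})$ as $x\to\infty$. If, in addition, $f_0\neq0$, then $f$ is said to belong to $\tilde{\mathbf{A}}^{(\gamma,m)}_0$ strictly. The function $w$ in the claim is assumed to be defined at all positive integers. An infinite product $\prod^\infty_{n=1}f_n$ is called convergent if $\lim_{n\to\infty}\prod^n_{k=1}f_k$ exists and is finite and nonzero; this limit is its value.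 Thus $S=\lim_{n\to\infty}A_n=\prod_{n=1}^\infty(1+v_n)$ is finite and nonzero. The notation $b_n\sim\alpha c_n$ as $n\to\infty$ (with $\alpha\ne0$) means $\lim_{n\to\infty}b_n/c_n=\alpha$. *)

(* Defs.v *)
From Stdlib Require Import Reals.
From Coquelicot Require Import Coquelicot.

Open Scope R_scope.

(* x^z = exp (z ln x) with the real logarithm; meaningful only for x > 0. *)
Definition xpow (x : R) (z : C) : C :=
  (RtoC (Rpower x (Re z)) * (cos (Im z * ln x), sin (Im z * ln x)))%C.

Lemma xpow_RtoC (x r : R) : xpow x (RtoC r) = RtoC (Rpower x r).
Proof.
unfold xpow; simpl; rewrite Rmult_0_l, cos_0, sin_0.
exact (Cmult_1_r _).
Qed.

Definition big_O_infty (f h : R -> C) : Prop :=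
  exists K : R,
    Rbar_locally p_infty (fun x : R => Cmod (f x) <= K * Cmod (h x)).

(* A function "defined for all large x" is a total function R -> C whose values
   away from +oo are irrelevant.  [sum_n u (N - 1)] is u 0 + ... + u (N - 1). *)
Definition has_expansion (gamma : C) (m : nat) (f : R -> C) (c : nat -> C)
  : Prop :=
  forall N : nat, (1 <= N)%nat ->
    big_O_infty
      (fun x => (f x -
         sum_n (fun i => c i * xpow x (gamma - RtoC (INR i / INR m)))
           (N - 1)%nat)%C)
      (fun x => xpow x (gamma - RtoC (INR N / INR m))%C).

Definition A0 (gamma : C) (m : nat) (f : R -> C) : Prop :=
  exists c : nat -> C, has_expansion gamma m f c.

Definition A0_strictly (gamma : C) (m : nat) (f : R -> C) : Prop :=
  exists c : nat -> C, has_expansion gamma m f c /\ c 0%nat <> RtoC 0.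

(* u 1 * u 2 * ... * u n; the value u 0 is not used. *)
Fixpoint partial_prod (u : nat -> C) (n : nat) : C :=
  match n with
  | O => RtoC 1
  | S k => (partial_prod u k * u (S k))%C
  end.

Definition inf_prod_converges_to (u : nat -> C) (l : C) : Prop :=
  filterlim (partial_prod u) eventually (locally l) /\ l <> RtoC 0.

(* b_n ~ alpha c_n; to be used together with alpha <> 0. *)
Definition seq_sim (b : nat -> C) (alpha : C) (c : nat -> C) : Prop :=
  filterlim (fun n => (b n / c n)%C) eventually (locally alpha).

(* Main.v *)
Require Import Defs.
From Stdlib Require Import Reals Lra Lia Classical IndefiniteDescription.
From Coquelicot Require Import Coquelicot.

(** Write [z_n = n^(-1/m)], [u_n = A_(n-1)], [s = t - m >= 1] and [v_n = z_n^t f_n], so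
    that [f] has a full expansion in powers of [z], with a nonzero leading
    coefficient [f_0].  The partial products solve the linear difference
    equation [u_(n+1) - u_n = v_n u_n] and tend to [S].

    The key fact is a summation principle: if [e] tends to 0 and
    [e_(n+1) - e_n = z_n^(m+k) b_n] with [k >= 1] and [b] expanded to order [N]
    in powers of [z], then [e_n / z_n^k] is expanded to the same order [N], and
    its leading coefficient is [- m/k] times that of [b] ([tail_expands_all],
    [tail_leads]).  One removes the leading term of [e] by subtracting a multiple
    of [z^k], whose difference is [z^(m+k)] times a sequence with a full expansion
    ([gauge_step_pow]), and inducts on [N]; for [N = 0] the sum telescopes
    against [z^k].

    Applied to [e = u - S], [b = f u] and [k = s], the principle bootstraps: an
    expansion of [u] to order [N] gives one of [(u - S) / z^s] to order [N], and
    so one of [u] to order [N + 1], because [s >= 1] ([recurrence_leads]).  Hence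
    [u] and [(u - S) / z^s] have full expansions, and the latter tends to
    [alpha = - f_0 S m/s], which is nonzero.  As [n a_n = z_n^s f_n u_n], the
    values [G_n = (u_n - S) / (n a_n)] have a full expansion with constant term
    [- m/s].

    It remains to pass from the integers to a real variable: a function with the
    same expansion exists by the Borel-Ritt construction ([borel_ritt]), and it
    may be overwritten by [G_n] at each integer [n]
    ([has_expansion_interpolate]). *)

Open Scope R_scope.

(** * Limits and bounds of complex sequences *)

Definition tends (a : nat -> C) (l : C) : Prop :=
  forall eps : R, 0 < eps -> eventually (fun n => Cmod (a n - l) < eps).

Lemma tends_filterlim (a : nat -> C) (l : C) :
  filterlim a eventually (locally l) <-> tends a l.
Proof.
rewrite (@filterlim_locally_ball_norm _ _ C_NormedModule eventually _).
split; intros H eps.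
- intros Heps. exact (H (mkposreal eps Heps)).
- exact (H eps (cond_pos eps)).
Qed.

Lemma tends_unique (a : nat -> C) (l l' : C) :
  tends a l -> tends a l' -> l = l'.
Proof.
intros H H'.
apply NNPP; intros Hne.
assert (Hp : 0 < Cmod (l - l')).
{ apply Cmod_gt_0. intros E. apply Hne.
  replace l with ((l - l') + l')%C by ring. rewrite E. ring. }
destruct (filter_and _ _ (H _ (is_pos_div_2 (mkposreal _ Hp)))
  (H' _ (is_pos_div_2 (mkposreal _ Hp)))) as [n Hn].
destruct (Hn n (Nat.le_refl n)) as [H1 H2]. simpl in H1, H2.
assert (Ht : Cmod (l - l') <= Cmod (a n - l) + Cmod (a n - l')).
{ replace (l - l')%C with (- (a n - l) + (a n - l'))%C by ring.
  eapply Rle_trans; [apply Cmod_triangle|]. rewrite Cmod_opp. lra. }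
lra.
Qed.

Lemma tends_bounded_away (a : nat -> C) (l : C) :
  l <> RtoC 0 -> tends a l ->
  eventually (fun n => Cmod l / 2 <= Cmod (a n)).
Proof.
intros Hl Ha.
assert (Hp : 0 < Cmod l) by now apply Cmod_gt_0.
generalize (Ha (Cmod l / 2) ltac:(lra)). apply filter_imp. intros n Hn.
assert (Ht : Cmod l <= Cmod (a n - l) + Cmod (a n)).
{ replace l with (- (a n - l) + a n)%C at 1 by ring.
  eapply Rle_trans; [apply Cmod_triangle|]. rewrite Cmod_opp. lra. }
lra.
Qed.

Lemma tends_plus (a b : nat -> C) (l l' : C) :
  tends a l -> tends b l' -> tends (fun n => (a n + b n)%C) (l + l')%C.
Proof.
intros Ha Hb eps Heps.
generalize (filter_and (F := eventually) _ _ (Ha (eps / 2) ltac:(lra)) (Hb (eps / 2) ltac:(lra))).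
apply filter_imp. intros n [H1 H2].
replace (a n + b n - (l + l'))%C with ((a n - l) + (b n - l'))%C by ring.
eapply Rle_lt_trans; [apply Cmod_triangle|]. lra.
Qed.

Definition bounded (a : nat -> C) : Prop :=
  exists K : R, eventually (fun n => Cmod (a n) <= K).

Lemma tends_bounded (a : nat -> C) (l : C) : tends a l -> bounded a.
Proof.
intros Ha. exists (Cmod l + 1).
generalize (Ha 1 Rlt_0_1). apply filter_imp. intros n Hn.
replace (a n) with (l + (a n - l))%C by ring.
eapply Rle_trans; [apply Cmod_triangle|]. lra.
Qed.

Lemma bounded_plus (a b : nat -> C) :
  bounded a -> bounded b -> bounded (fun n => (a n + b n)%C).
Proof.
intros [K HK] [L HL]. exists (K + L).
generalize (filter_and _ _ HK HL). apply filter_imp. intros n [H1 H2].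
eapply Rle_trans; [apply Cmod_triangle|]. lra.
Qed.

Lemma bounded_mult (a b : nat -> C) :
  bounded a -> bounded b -> bounded (fun n => (a n * b n)%C).
Proof.
intros [K HK] [L HL]. exists (K * L).
generalize (filter_and _ _ HK HL). apply filter_imp. intros n [H1 H2].
rewrite Cmod_mult. apply Rmult_le_compat; auto using Cmod_ge_0.
Qed.

(** * Expansions in powers of a null sequence *)

Fixpoint geom_sum (x : C) (k : nat) : C :=
  match k with
  | O => RtoC 0
  | S k' => (geom_sum x k' + x ^ k')%C
  end.

Lemma geom_sum_spec (x : C) (k : nat) : ((x - 1) * geom_sum x k = x ^ k - 1)%C.
Proof.
induction k as [|k IH]; simpl; [ring|].
replace ((x - 1) * (geom_sum x k + x ^ k))%C
  with ((x - 1) * geom_sum x k + (x - 1) * x ^ k)%C by ring.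
rewrite IH. ring.
Qed.

Lemma geom_sum_ge1 (r : R) (k : nat) :
  0 < r -> 1 <= Cmod (geom_sum (RtoC r) (S k)).
Proof.
intros Hr.
assert (H : exists s : R, geom_sum (RtoC r) (S k) = RtoC s /\ 1 <= s).
{ induction k as [|k [s [E Hs]]].
  - exists 1. split; [simpl; ring|lra].
  - exists (s + r ^ S k). split.
    + change (geom_sum (RtoC r) (S (S k)))
        with (geom_sum (RtoC r) (S k) + RtoC r ^ S k)%C.
      now rewrite E, RtoC_plus, RtoC_pow.
    + generalize (pow_lt r (S k) Hr); lra. }
destruct H as [s [-> Hs]]. rewrite Cmod_R, Rabs_pos_eq; lra.
Qed.

Section Gauge.

Variable z : nat -> C.
Hypothesis z_tends0 : tends z (RtoC 0).

(** An expansion of [a] to order [N] in powers of [z] with remainder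
    [O(z^N)], written in nested (Horner) form.  The coefficients are kept
    existential, so that closure under the algebraic operations is a short
    induction on [N] which never writes a Cauchy product.  See
    [approx_expands] and [expands_coefficients] for the link with explicit
    truncated sums. *)
Fixpoint expands (N : nat) (a : nat -> C) : Prop :=
  match N with
  | O => bounded a
  | S N' => exists (c : C) (a' : nat -> C), expands N' a' /\
      eventually (fun n => a n = (c + z n * a' n)%C)
  end.

(** The expansion of order [S N] with its constant term made visible. *)
Definition leads (N : nat) (c : C) (a : nat -> C) : Prop :=
  exists a' : nat -> C, expands N a' /\
    eventually (fun n => a n = (c + z n * a' n)%C).

Lemma leads_expands N c a : leads N c a -> expands (S N) a.
Proof. intros H; exists c; exact H. Qed.

Lemma expands_ext N a b :
  eventually (fun n => a n = b n) -> expands N a -> expands N b.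
Proof.
intros Hab. destruct N as [|N].
- intros [K HK]. exists K.
  generalize (filter_and _ _ Hab HK). apply filter_imp.
  intros n [H1 H2]. now rewrite <- H1.
- intros [c [a' [Ha' E]]]. exists c, a'. split; [exact Ha'|].
  generalize (filter_and _ _ Hab E). apply filter_imp.
  intros n [H1 H2]. now rewrite <- H1.
Qed.

Lemma leads_ext N c a b :
  eventually (fun n => a n = b n) -> leads N c a -> leads N c b.
Proof.
intros Hab [a' [Ha' E]]. exists a'. split; [exact Ha'|].
generalize (filter_and _ _ Hab E). apply filter_imp.
intros n [H1 H2]. now rewrite <- H1.
Qed.

Lemma leads_eq N c d a : c = d -> leads N c a -> leads N d a.
Proof. now intros ->. Qed.

Lemma expands_const N c : expands N (fun _ => c).
Proof.
revert c; induction N as [|N IH]; intros c.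
- exists (Cmod c). apply filter_forall. intros _; lra.
- exists c, (fun _ => RtoC 0). split; [apply IH|].
  apply filter_forall. intros n; ring.
Qed.

Lemma leads_const N c : leads N c (fun _ => c).
Proof.
exists (fun _ => RtoC 0). split; [apply expands_const|].
apply filter_forall. intros n; ring.
Qed.

Lemma leads_gauge_mult N a : expands N a -> leads N (RtoC 0) (fun n => (z n * a n)%C).
Proof.
intros Ha. exists a. split; [exact Ha|].
apply filter_forall. intros n; ring.
Qed.

Lemma expands_pred N a : expands (S N) a -> expands N a.
Proof.
revert a; induction N as [|N IH]; intros a [c [a' [Ha' E]]].
- apply (expands_ext 0 (fun n => (c + z n * a' n)%C)).
  + generalize E. apply filter_imp. now intros n ->.
  + apply bounded_plus; [apply (expands_const 0)|].
    apply bounded_mult; [|exact Ha']. exact (tends_bounded _ _ z_tends0).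
- exists c, a'. split; [exact (IH _ Ha')|exact E].
Qed.

Lemma expands_plus N a b :
  expands N a -> expands N b -> expands N (fun n => (a n + b n)%C).
Proof.
revert a b; induction N as [|N IH]; intros a b.
- apply bounded_plus.
- intros [c [a' [Ha' Ea]]] [d [b' [Hb' Eb]]].
  exists (c + d)%C, (fun n => (a' n + b' n)%C). split; [now apply IH|].
  generalize (filter_and _ _ Ea Eb). apply filter_imp.
  intros n [-> ->]. ring.
Qed.

Lemma leads_plus N c d a b :
  leads N c a -> leads N d b -> leads N (c + d)%C (fun n => (a n + b n)%C).
Proof.
intros [a' [Ha' Ea]] [b' [Hb' Eb]].
exists (fun n => (a' n + b' n)%C). split; [now apply expands_plus|].
generalize (filter_and _ _ Ea Eb). apply filter_imp.
intros n [-> ->]. ring.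
Qed.

Lemma expands_gauge_mult N a : expands N a -> expands N (fun n => (z n * a n)%C).
Proof.
intros Ha. apply expands_pred, (leads_expands _ (RtoC 0)).
now apply leads_gauge_mult.
Qed.

Lemma expands_mult N a b :
  expands N a -> expands N b -> expands N (fun n => (a n * b n)%C).
Proof.
revert a b; induction N as [|N IH]; intros a b.
- apply bounded_mult.
- intros [c [a' [Ha' Ea]]] [d [b' [Hb' Eb]]].
  exists (c * d)%C,
    (fun n => (c * b' n + (d * a' n + z n * (a' n * b' n)))%C).
  split.
  + apply expands_plus; [apply IH; [apply expands_const|exact Hb']|].
    apply expands_plus; [apply IH; [apply expands_const|exact Ha']|].
    apply expands_gauge_mult. now apply IH.
  + generalize (filter_and _ _ Ea Eb). apply filter_imp.
    intros n [-> ->]. ring.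
Qed.

Lemma leads_mult N c d a b :
  leads N c a -> leads N d b -> leads N (c * d)%C (fun n => (a n * b n)%C).
Proof.
intros [a' [Ha' Ea]] [b' [Hb' Eb]].
exists (fun n => (c * b' n + (d * a' n + z n * (a' n * b' n)))%C).
split.
- apply expands_plus; [apply expands_mult; [apply expands_const|exact Hb']|].
  apply expands_plus; [apply expands_mult; [apply expands_const|exact Ha']|].
  apply expands_gauge_mult. now apply expands_mult.
- generalize (filter_and _ _ Ea Eb). apply filter_imp.
  intros n [-> ->]. ring.
Qed.

Lemma expands_bounded N a : expands N a -> bounded a.
Proof.
induction N as [|N IH]; [easy|]. intros H. now apply IH, expands_pred.
Qed.

Lemma leads_tends N c a : leads N c a -> tends a c.
Proof.
intros [a' [Ha' E]]. destruct (expands_bounded _ _ Ha') as [K HK].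
intros eps Heps.
assert (HK1 : 0 < Rmax K 0 + 1) by (generalize (Rmax_r K 0); lra).
assert (Hd : 0 < eps / (Rmax K 0 + 1)) by now apply Rdiv_lt_0_compat.
generalize (filter_and _ _ E (filter_and _ _ HK (z_tends0 _ Hd))).
apply filter_imp. intros n [H1 [H2 H3]]. rewrite H1.
replace (c + z n * a' n - c)%C with ((z n - RtoC 0) * a' n)%C by ring.
rewrite Cmod_mult.
apply Rle_lt_trans with (Cmod (z n - RtoC 0) * (Rmax K 0 + 1)).
- apply Rmult_le_compat_l; [apply Cmod_ge_0|]. generalize (Rmax_l K 0); lra.
- apply Rmult_lt_compat_r with (r := Rmax K 0 + 1) in H3; [|exact HK1].
  unfold Rdiv in H3. rewrite Rmult_assoc, Rinv_l, Rmult_1_r in H3; lra.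
Qed.

Lemma eventually_neq0 a (d : R) :
  0 < d -> eventually (fun n => d <= Cmod (a n)) ->
  eventually (fun n => a n <> RtoC 0).
Proof.
intros Hd. apply filter_imp. intros n Hn E. rewrite E, Cmod_0 in Hn. lra.
Qed.

Lemma leads_bounded_away N c a (d : R) :
  0 < d -> eventually (fun n => d <= Cmod (a n)) -> leads N c a ->
  c <> RtoC 0.
Proof.
intros Hd Ha Hl Hc. rewrite Hc in Hl.
destruct (filter_and _ _ Ha (leads_tends _ _ _ Hl d Hd)) as [n Hn].
destruct (Hn n (Nat.le_refl n)) as [H1 H2].
replace (a n - RtoC 0)%C with (a n) in H2 by ring. lra.
Qed.

(** From [a = c + z a'] follows [1/a = 1/c - z (a' / c) (1/a)], so order [N] of
    [1/a] on the right gives order [S N] on the left. *)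
Lemma expands_inv N a (d : R) :
  0 < d -> eventually (fun n => d <= Cmod (a n)) ->
  expands N a -> expands N (fun n => (/ a n)%C).
Proof.
intros Hd Ha. assert (Hne := eventually_neq0 _ _ Hd Ha).
induction N as [|N IH]; intros HN.
- exists (/ d). generalize (filter_and _ _ Ha Hne). apply filter_imp.
  intros n [H1 H2]. rewrite Cmod_inv by exact H2.
  now apply Rinv_le_contravar.
- assert (Hinv := IH (expands_pred _ _ HN)).
  destruct HN as [c [a' [Ha' E]]].
  assert (Hc : c <> RtoC 0).
  { apply (leads_bounded_away N c a d Hd Ha). now exists a'. }
  exists (/ c)%C, (fun n => (- / c * (a' n * / a n))%C). split.
  + apply expands_mult; [apply expands_const|]. now apply expands_mult.
  + generalize (filter_and _ _ E Hne). apply filter_imp. intros n [H1 H2].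
    replace (z n * (- / c * (a' n * / a n)))%C
      with (- / c * (a n - c) * / a n)%C by (rewrite H1 at 1; field; auto).
    field; auto.
Qed.

Lemma leads_expands_tends N c a :
  leads N c a <-> expands (S N) a /\ tends a c.
Proof.
split.
- intros H; split; [now apply leads_expands with c|].
  now apply leads_tends with N.
- intros [[c' H] Hc].
  rewrite (tends_unique _ _ _ Hc (leads_tends _ _ _ H)). exact H.
Qed.

Lemma leads_inv N c a :
  c <> RtoC 0 -> leads N c a -> leads N (/ c)%C (fun n => (/ a n)%C).
Proof.
intros Hc H.
assert (Hp : 0 < Cmod c / 2) by (apply Cmod_gt_0 in Hc; lra).
assert (Ha := tends_bounded_away _ _ Hc (leads_tends _ _ _ H)).
destruct (expands_inv (S N) a _ Hp Ha (leads_expands _ _ _ H))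
  as [c' H'].
replace (/ c)%C with c'; [exact H'|].
(* Some constant term [c'] exists; comparing the limits of [a * / a]
   identifies it. *)
assert (E : (c * c' = 1)%C).
{ apply (tends_unique (fun n => (a n * / a n)%C)).
  - apply leads_tends with N. now apply leads_mult.
  - apply leads_tends with N.
    apply leads_ext with (fun _ => RtoC 1); [|apply leads_const].
    generalize (eventually_neq0 _ _ Hp Ha). apply filter_imp.
    intros n Hn. field; exact Hn. }
replace c' with (/ c * (c * c'))%C by (field; exact Hc). rewrite E. ring.
Qed.

Lemma leads_pow N a k : leads N (RtoC 1) a -> leads N (RtoC 1) (fun n => (a n ^ k)%C).
Proof.
intros Ha. induction k as [|k IH]; [apply (leads_const N (RtoC 1))|].
simpl. replace (RtoC 1) with (RtoC 1 * RtoC 1)%C by ring.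
now apply leads_mult.
Qed.

Lemma expands_gauge N : expands N z.
Proof.
apply expands_ext with (fun n => (z n * RtoC 1)%C).
- apply filter_forall. intros n; ring.
- apply expands_gauge_mult, expands_const.
Qed.

Lemma expands_pow N a k : expands N a -> expands N (fun n => (a n ^ k)%C).
Proof.
intros Ha. induction k as [|k IH]; [apply (expands_const N (RtoC 1))|].
now apply expands_mult.
Qed.

Lemma leads_gauge_pow N k : (1 <= k)%nat -> leads N (RtoC 0) (fun n => (z n ^ k)%C).
Proof.
intros Hk. destruct k as [|k]; [lia|].
apply leads_gauge_mult, expands_pow, expands_gauge.
Qed.

Lemma expands_geom N a k :
  expands N a -> expands N (fun n => geom_sum (a n) k).
Proof.
intros Ha.
induction k as [|k IH]; [apply (expands_const N (RtoC 0))|].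
apply expands_plus; [exact IH|]. now apply expands_pow.
Qed.

Lemma leads_geom N a k :
  leads N (RtoC 1) a -> leads N (RtoC (INR k)) (fun n => geom_sum (a n) k).
Proof.
intros Ha. induction k as [|k IH]; [apply (leads_const N (RtoC 0))|].
rewrite S_INR, RtoC_plus. apply leads_plus; [exact IH|].
now apply leads_pow.
Qed.

(** The expansion of an [m]-th root, without a binomial series: in
    [r - 1 = (r^m - 1) / (1 + r + ... + r^(m-1))] the numerator is [z p], so an
    expansion of [r] to order [N] on the right yields order [S N].  The
    denominator stays away from 0 because [r > 0]. *)
Lemma leads_root (m : nat) (r : nat -> R) (p : nat -> C) :
  (1 <= m)%nat ->
  eventually (fun n => 0 < r n <= 1) ->
  (forall N, expands N p) ->
  eventually (fun n => (RtoC (r n) ^ m = 1 + z n * p n)%C) ->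
  forall N, leads N (RtoC 1) (fun n => RtoC (r n)).
Proof.
intros Hm Hr Hp E.
destruct m as [|m]; [lia|].
assert (Hge : eventually (fun n => 1 <= Cmod (geom_sum (RtoC (r n)) (S m)))).
{ generalize Hr. apply filter_imp. intros n [H _]. now apply geom_sum_ge1. }
assert (step : forall N, expands N (fun n => RtoC (r n)) ->
          leads N (RtoC 1) (fun n => RtoC (r n))).
{ intros N HN.
  exists (fun n => (p n * / geom_sum (RtoC (r n)) (S m))%C). split.
  - apply expands_mult; [apply Hp|].
    apply expands_inv with 1; [lra|exact Hge|]. now apply expands_geom.
  - generalize (filter_and _ _ E
      (eventually_neq0 _ _ Rlt_0_1 Hge)).
    apply filter_imp. intros n [H1 H2].
    assert (H3 := geom_sum_spec (RtoC (r n)) (S m)). rewrite H1 in H3.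
    replace (z n * (p n * / geom_sum (RtoC (r n)) (S m)))%C
      with ((1 + z n * p n - 1) * / geom_sum (RtoC (r n)) (S m))%C by ring.
    rewrite <- H3. field; exact H2. }
intros N. apply step. induction N as [|N IH].
- exists 1. generalize Hr. apply filter_imp. intros n [H1 H2].
  rewrite Cmod_R, Rabs_pos_eq; lra.
- apply leads_expands with (RtoC 1). now apply step.
Qed.

End Gauge.

(** * The gauge n^(-1/m) and differences of its powers *)

Definition rho (m : nat) (x : R) : R := Rpower x (- / INR m).

Definition gauge (m n : nat) : C := RtoC (rho m (INR n)).

Lemma rho_pos m x : 0 < rho m x.
Proof. apply exp_pos. Qed.

Lemma rho_pow m x k : rho m x ^ k = Rpower x (- INR k / INR m).
Proof.
rewrite <- Rpower_pow by apply rho_pos. unfold rho. rewrite Rpower_mult.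
f_equal. unfold Rdiv. ring.
Qed.

Lemma rho_pow_m m x : (1 <= m)%nat -> 0 < x -> rho m x ^ m = / x.
Proof.
intros Hm Hx. assert (0 < INR m) by (apply lt_0_INR; lia).
rewrite rho_pow. replace (- INR m / INR m) with (- (1)) by (field; lra).
rewrite Rpower_Ropp, Rpower_1; auto.
Qed.

Lemma rho_decr m x y : (1 <= m)%nat -> 0 < x -> x <= y -> rho m y <= rho m x.
Proof.
intros Hm Hx Hxy. assert (0 < INR m) by (apply lt_0_INR; lia).
unfold rho. rewrite 2!Rpower_Ropp.
apply Rinv_le_contravar; [apply exp_pos|].
apply Rle_Rpower_l; [|lra]. left. now apply Rinv_0_lt_compat.
Qed.

Lemma rho_small m (d : R) : (1 <= m)%nat -> 0 < d ->
  exists X : R, 0 < X /\ forall x, X < x -> rho m x < d.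
Proof.
intros Hm Hd. exists (/ d ^ m).
assert (Hp : 0 < d ^ m) by now apply pow_lt.
split; [now apply Rinv_0_lt_compat|]. intros x Hx.
assert (Hx0 : 0 < x) by (eapply Rlt_trans; [|exact Hx]; now apply Rinv_0_lt_compat).
apply Rnot_le_lt. intros Hle.
assert (H := pow_incr d (rho m x) m (conj (Rlt_le _ _ Hd) Hle)).
rewrite rho_pow_m in H by assumption.
apply Rinv_lt_contravar in Hx; [|apply Rmult_lt_0_compat; [now apply Rinv_0_lt_compat|exact Hx0]].
rewrite Rinv_inv in Hx. lra.
Qed.

Lemma eventually_INR_gt (X : R) : eventually (fun n => X < INR n).
Proof.
destruct (INR_unbounded X) as [n0 H0]. exists n0. intros n Hn.
apply le_INR in Hn. lra.
Qed.

Lemma gauge_neq0 m n : gauge m n <> RtoC 0.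
Proof.
intros E. apply RtoC_inj in E. generalize (rho_pos m (INR n)). lra.
Qed.

Lemma Cmod_gauge m n : Cmod (gauge m n) = rho m (INR n).
Proof. unfold gauge. rewrite Cmod_R. apply Rabs_pos_eq. left; apply rho_pos. Qed.

Lemma gauge_tends0 m : (1 <= m)%nat -> tends (gauge m) (RtoC 0).
Proof.
intros Hm eps Heps. destruct (rho_small m eps Hm Heps) as [X [_ HX]].
generalize (eventually_INR_gt X). apply filter_imp. intros n Hn.
replace (gauge m n - RtoC 0)%C with (gauge m n) by ring.
rewrite Cmod_gauge. now apply HX.
Qed.

Section Summation.

Variable m : nat.
Hypothesis Hm : (1 <= m)%nat.

Let z := gauge m.
Let z_tends0 : tends z (RtoC 0) := gauge_tends0 m Hm.

Lemma gauge_pow_m n : (1 <= n)%nat -> (RtoC (INR n) * gauge m n ^ m = 1)%C.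
Proof.
intros Hn. assert (0 < INR n) by (apply lt_0_INR; lia).
unfold gauge. rewrite <- RtoC_pow, rho_pow_m, <- RtoC_mult by assumption.
f_equal. field. lra.
Qed.

(** Let [r_n = z_(n+1) / z_n].  As [r^m = 1 / (1 + z^m)], the ratio [r] is an
    [m]-th root of an expandable sequence, and
    [z_(n+1)^k - z_n^k = z_n^k (r^k - 1)] with
    [r^k - 1 = (r^m - 1) (1 + ... + r^(k-1)) / (1 + ... + r^(m-1))]. *)
Lemma gauge_step_pow (k : nat) :
  exists q : nat -> C,
    (forall N, leads z N (RtoC (- (INR k / INR m))) q) /\
    eventually (fun n => (z (S n) ^ k - z n ^ k = z n ^ (m + k) * q n)%C).
Proof.
set (r := fun n => rho m (INR (S n)) / rho m (INR n)).
assert (Hrn : forall n, 0 < r n).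
{ intros n. apply Rdiv_lt_0_compat; apply rho_pos. }
assert (Hz : forall n, z (S n) = (z n * RtoC (r n))%C).
{ intros n. unfold z, gauge, r. rewrite <- RtoC_mult. f_equal.
  field. generalize (rho_pos m (INR n)); lra. }
assert (Hpos1 : eventually (fun n => (1 <= n)%nat)) by (exists 1%nat; auto).
assert (HmR : 0 < INR m) by (apply lt_0_INR; lia).
(* Because [z n ^ m = 1 / n], this says that [r n ^ m = n / (n + 1)]. *)
assert (Hrm : eventually (fun n =>
          (RtoC (r n) ^ m * (1 + z n ^ m) = 1)%C)).
{ generalize Hpos1. apply filter_imp. intros n Hn.
  assert (Hn0 : 0 < INR n) by (apply lt_0_INR; lia).
  assert (HS0 : 0 < INR (S n)) by (apply lt_0_INR; lia).
  unfold z, gauge. rewrite <- !RtoC_pow, <- RtoC_plus, <- RtoC_mult.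
  f_equal. unfold r. unfold Rdiv. rewrite Rpow_mult_distr, pow_inv.
  rewrite !rho_pow_m by assumption. rewrite S_INR in *. field. lra. }
assert (Hden : forall N, leads z N (RtoC 1) (fun n => (1 + z n ^ m)%C)).
{ intros N. apply leads_eq with (RtoC 1 + RtoC 0)%C; [ring|].
  apply leads_plus; [apply (leads_const z N (RtoC 1))|].
  now apply leads_gauge_pow. }
assert (Hden0 : eventually (fun n => (1 + z n ^ m)%C <> RtoC 0)).
{ generalize Hrm. apply filter_imp. intros n H E. rewrite E in H.
  apply C1_nz. rewrite <- H. ring. }
assert (Hroot : forall N, leads z N (RtoC 1) (fun n => RtoC (r n))).
{ apply (leads_root z z_tends0 m r
    (fun n => (- (z n ^ (m - 1) * / (1 + z n ^ m)))%C)); [exact Hm| | |].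
  - generalize Hpos1. apply filter_imp. intros n Hn. split; [apply Hrn|].
    apply Rmult_le_reg_r with (rho m (INR n)); [apply rho_pos|].
    unfold r, Rdiv. rewrite Rmult_assoc, Rinv_l, Rmult_1_r, Rmult_1_l
      by (generalize (rho_pos m (INR n)); lra).
    apply rho_decr; [exact Hm| |apply le_INR; lia].
    apply lt_0_INR; lia.
  - intros N.
    apply expands_ext with
      (fun n => (- (1) * (z n ^ (m - 1) * / (1 + z n ^ m)))%C);
      [apply filter_forall; intros n; ring|].
    apply expands_mult; [exact z_tends0|apply (expands_const z N (- (1))%C)|].
    apply expands_mult; [exact z_tends0| |].
    + apply expands_pow; [exact z_tends0|]. now apply expands_gauge.
    + apply expands_pred; [exact z_tends0|].
      apply leads_expands with (/ 1)%C.
      apply leads_inv; [exact z_tends0|apply C1_nz|apply Hden].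
  - generalize (filter_and _ _ Hrm Hden0). apply filter_imp.
    intros n [H1 H2].
    replace (z n * - (z n ^ (m - 1) * / (1 + z n ^ m)))%C
      with (- (z n ^ S (m - 1) * / (1 + z n ^ m)))%C by (simpl; ring).
    replace (S (m - 1)) with m by lia.
    replace (RtoC (r n) ^ m)%C
      with ((RtoC (r n) ^ m * (1 + z n ^ m)) * / (1 + z n ^ m))%C
      by (field; exact H2).
    rewrite H1. field; exact H2. }
assert (HmC : RtoC (INR m) <> RtoC 0) by (intros E; apply RtoC_inj in E; lra).
exists (fun n => (- (1) * (/ ((1 + z n ^ m) * geom_sum (RtoC (r n)) m)
                           * geom_sum (RtoC (r n)) k))%C).
split.
- intros N.
  apply leads_eq with (- (1) * (/ (1 * RtoC (INR m)) * RtoC (INR k)))%C.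
  + rewrite RtoC_opp, RtoC_div by lra. field. exact HmC.
  + apply leads_mult; [exact z_tends0|apply (leads_const z N (- (1))%C)|].
    apply leads_mult; [exact z_tends0| |now apply leads_geom].
    apply leads_inv; [exact z_tends0| |].
    * now rewrite Cmult_1_l.
    * apply leads_mult; [exact z_tends0|apply Hden|now apply leads_geom].
- assert (Hge : eventually (fun n => 1 <= Cmod (geom_sum (RtoC (r n)) m))).
  { apply filter_forall. intros n. replace m with (S (m - 1)) by lia.
    now apply geom_sum_ge1. }
  generalize (filter_and _ _ Hrm (filter_and _ _ Hden0
    (eventually_neq0 _ _ Rlt_0_1 Hge))).
  apply filter_imp. intros n [H1 [H2 H3]].
  rewrite Hz, Cpow_mult_l, Cpow_add_r.
  replace (z n ^ k * RtoC (r n) ^ k - z n ^ k)%C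
    with (z n ^ k * (RtoC (r n) ^ k - 1))%C by ring.
  rewrite <- (geom_sum_spec (RtoC (r n)) k).
  assert (H4 : (z n ^ m = - (RtoC (r n) - 1) * geom_sum (RtoC (r n)) m * (1 + z n ^ m))%C).
  { replace (- (RtoC (r n) - 1) * geom_sum (RtoC (r n)) m * (1 + z n ^ m))%C
      with ((1 + z n ^ m) - ((RtoC (r n) - 1) * geom_sum (RtoC (r n)) m + 1) * (1 + z n ^ m))%C
      by ring.
    rewrite geom_sum_spec.
    replace (RtoC (r n) ^ m - 1 + 1)%C with (RtoC (r n) ^ m)%C by ring.
    rewrite H1. ring. }
  rewrite H4 at 1. field. split; assumption.
Qed.

(** * Summation of expansions *)

(** The increments [z^(m+k)] are comparable, by [gauge_step_pow], with the
    decrements of the decreasing sequence [z^k]; so the sum of [e (S n) - e n]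
    from [n] on telescopes to [O(z_n^k)]. *)
Lemma tail_bounded (k : nat) (e b : nat -> C) :
  (1 <= k)%nat -> tends e (RtoC 0) -> bounded b ->
  eventually (fun n => (e (S n) - e n = z n ^ (m + k) * b n)%C) ->
  bounded (fun n => (e n / z n ^ k)%C).
Proof.
intros Hk He [K HK] E.
assert (HmR : 0 < INR m) by (apply lt_0_INR; lia).
assert (HkR : 0 < INR k) by (apply lt_0_INR; lia).
destruct (gauge_step_pow k) as [q [Hq Eq]].
assert (Hc : RtoC (- (INR k / INR m)) <> RtoC 0).
{ intros E0. apply RtoC_inj in E0.
  generalize (Rdiv_lt_0_compat _ _ HkR HmR). lra. }
assert (Hd := tends_bounded_away _ _ Hc (leads_tends z z_tends0 _ _ _ (Hq 0%nat))).
set (d := Cmod (RtoC (- (INR k / INR m))) / 2) in Hd.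
assert (Hdpos : 0 < d) by (apply Cmod_gt_0 in Hc; unfold d; lra).
set (P := fun n => rho m (INR n) ^ k).
(* [d] bounds [Cmod (q n)] from below, and [K] bounds [Cmod (b n)]. *)
set (L := Rmax K 0 / d).
assert (HL : 0 <= L).
{ apply Rmult_le_pos; [apply Rmax_r|]. left; now apply Rinv_0_lt_compat. }
assert (Hpos1 : eventually (fun n => (1 <= n)%nat)) by (exists 1%nat; auto).
destruct (filter_and _ _ HK (filter_and _ _ E (filter_and _ _ Eq
  (filter_and _ _ Hd Hpos1)))) as [n0 Hn0].
assert (Hstep : forall n, (n0 <= n)%nat ->
          Cmod (e n) <= Cmod (e (S n)) + L * (P n - P (S n))).
{ intros n Hn. destruct (Hn0 n Hn) as [H1 [H2 [H3 [H4 H5]]]].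
  assert (Hdiff : Cmod (z n ^ (m + k)) * d <= P n - P (S n)).
  { replace (P n - P (S n)) with (Cmod (z (S n) ^ k - z n ^ k)).
    - rewrite H3, Cmod_mult. apply Rmult_le_compat_l; [apply Cmod_ge_0|exact H4].
    - unfold z, gauge. rewrite <- !RtoC_pow, <- RtoC_minus, Cmod_R.
      fold (P n) (P (S n)). rewrite <- Rabs_Ropp, Rabs_pos_eq; [ring|].
      assert (P (S n) <= P n); [|lra].
      apply pow_incr. split; [left; apply rho_pos|].
      apply rho_decr; [exact Hm|apply lt_0_INR; lia|apply le_INR; lia]. }
  assert (Hs : Cmod (e (S n) - e n) <= L * (P n - P (S n))).
  { rewrite H2, Cmod_mult.
    apply Rle_trans with (Cmod (z n ^ (m + k)) * Rmax K 0).
    - apply Rmult_le_compat_l; [apply Cmod_ge_0|]. generalize (Rmax_l K 0); lra.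
    - replace (Cmod (z n ^ (m + k)) * Rmax K 0)
        with (L * (Cmod (z n ^ (m + k)) * d)) by (unfold L; field; lra).
      now apply Rmult_le_compat_l. }
  replace (e n) with (e (S n) + - (e (S n) - e n))%C at 1 by ring.
  eapply Rle_trans; [apply Cmod_triangle|]. rewrite Cmod_opp. lra. }
assert (Htel : forall j n, (n0 <= n)%nat ->
          Cmod (e n) <= Cmod (e (n + j)%nat) + L * (P n - P (n + j)%nat)).
{ induction j as [|j IH]; intros n Hn.
  - rewrite Nat.add_0_r. lra.
  - eapply Rle_trans; [apply (IH n Hn)|].
    replace (n + S j)%nat with (S (n + j)) by lia.
    generalize (Hstep (n + j)%nat ltac:(lia)). lra. }
exists L. exists n0. intros n Hn.
assert (HPn : 0 < P n) by (apply pow_lt, rho_pos).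
assert (Hfin : Cmod (e n) <= L * P n).
{ apply le_epsilon. intros eps Heps.
  destruct (He eps Heps) as [n1 Hn1].
  assert (H1 := Hn1 (n + n1)%nat ltac:(lia)).
  replace (e (n + n1)%nat - RtoC 0)%C with (e (n + n1)%nat) in H1 by ring.
  assert (H2 := Htel n1 n Hn).
  assert (0 < P (n + n1)%nat) by (apply pow_lt, rho_pos).
  assert (0 <= L * P (n + n1)%nat) by (apply Rmult_le_pos; lra).
  lra. }
unfold z, gauge. rewrite <- RtoC_pow. fold (P n).
rewrite Cmod_div by (intros E0; apply RtoC_inj in E0; lra).
rewrite Cmod_R, Rabs_pos_eq by lra.
apply Rmult_le_reg_r with (P n); [exact HPn|].
unfold Rdiv. rewrite Rmult_assoc, Rinv_l, Rmult_1_r; lra.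
Qed.

(** Since [e] tends to 0, it is minus the sum of its later increments.  The
    exponent [k] is quantified here because the induction on [N] raises it. *)
Definition tail_expands (N : nat) : Prop :=
  forall (k : nat) (e b : nat -> C),
  (1 <= k)%nat -> tends e (RtoC 0) -> expands z N b ->
  eventually (fun n => (e (S n) - e n = z n ^ (m + k) * b n)%C) ->
  expands z N (fun n => (e n / z n ^ k)%C).

(** Subtracting [c z^k] from [e], with [c] chosen to cancel the leading term of
    the increments, leaves a sequence whose increments are of order
    [z^(m+k+1)]. *)
Lemma tail_leads (N k : nat) (e b : nat -> C) (d : C) :
  tail_expands N ->
  (1 <= k)%nat -> tends e (RtoC 0) -> leads z N d b ->
  eventually (fun n => (e (S n) - e n = z n ^ (m + k) * b n)%C) ->
  leads z N (- (d * RtoC (INR m / INR k)))%C (fun n => (e n / z n ^ k)%C).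
Proof.
intros IH Hk He [b' [Hb' Eb]] E.
assert (HmR : 0 < INR m) by (apply lt_0_INR; lia).
assert (HkR : 0 < INR k) by (apply lt_0_INR; lia).
set (c := (- (d * RtoC (INR m / INR k)))%C).
destruct (gauge_step_pow k) as [q [Hq Eq]].
destruct (Hq N) as [q' [Hq' Eq']].
set (e1 := fun n => (e n + - c * z n ^ k)%C).
exists (fun n => (e1 n / z n ^ S k)%C). split.
- apply (IH (S k) e1 (fun n => (b' n + - c * q' n)%C)); [lia| | |].
  + replace (RtoC 0) with (RtoC 0 + - c * 0)%C by ring.
    apply tends_plus; [exact He|].
    apply (leads_tends z z_tends0 0).
    apply leads_mult; [exact z_tends0|apply leads_const|].
    now apply leads_gauge_pow.
  + apply expands_plus; [exact Hb'|].
    apply expands_mult; [exact z_tends0|apply expands_const|exact Hq'].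
  + generalize (filter_and _ _ E (filter_and _ _ Eb (filter_and _ _ Eq Eq'))).
    apply filter_imp. intros n [H1 [H2 [H3 H4]]]. unfold e1.
    replace (e (S n) + - c * z (S n) ^ k - (e n + - c * z n ^ k))%C
      with ((e (S n) - e n) - c * (z (S n) ^ k - z n ^ k))%C by ring.
    rewrite H1, H2, H3, H4.
    replace (m + S k)%nat with (S (m + k)) by lia. simpl.
    assert (Hd : (c * RtoC (- (INR k / INR m)) = d)%C).
    { unfold c. rewrite RtoC_opp, !RtoC_div by lra. field.
      split; intros E0; apply RtoC_inj in E0; lra. }
    rewrite <- Hd at 1. ring.
- apply filter_forall. intros n. unfold e1. simpl.
  assert (Hz := gauge_neq0 m n). fold z in Hz.
  assert (Hzk := Cpow_nz _ k Hz). field. split; assumption.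
Qed.

Lemma tail_expands_all (N : nat) : tail_expands N.
Proof.
induction N as [|N IH]; intros k e b Hk He Hb E.
- now apply tail_bounded with b.
- destruct Hb as [d Hd].
  exists (- (d * RtoC (INR m / INR k)))%C.
  now apply tail_leads with b.
Qed.

(** Each order of [u] known on the right of the difference equation yields, after
    summation, [s >= 1] further orders of [u]. *)
Lemma recurrence_leads (s : nat) (u f : nat -> C) (l f0 : C) :
  (1 <= s)%nat -> tends u l ->
  (forall N, leads z N f0 f) ->
  eventually (fun n => (u (S n) - u n = z n ^ (m + s) * (f n * u n))%C) ->
  (forall N, leads z N l u) /\
  (forall N, leads z N (- (f0 * l * RtoC (INR m / INR s)))%C
               (fun n => ((u n - l) / z n ^ s)%C)).
Proof.
intros Hs Hu Hf E.
set (e := fun n => (u n - l)%C).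
assert (He : tends e (RtoC 0)).
{ replace (RtoC 0) with (l + - l)%C by ring.
  apply (tends_plus u (fun _ => (- l)%C)); [exact Hu|].
  apply (leads_tends z z_tends0 0), leads_const. }
assert (Ee : eventually (fun n =>
          (e (S n) - e n = z n ^ (m + s) * (f n * u n))%C)).
{ generalize E. apply filter_imp. intros n H. rewrite <- H. unfold e. ring. }
assert (Hul : forall N, expands z N u -> leads z N l u).
{ intros N HN.
  exists (fun n => (z n ^ (s - 1) * (e n / z n ^ s))%C). split.
  - apply expands_mult; [exact z_tends0| |].
    + apply expands_pow; [exact z_tends0|]. now apply expands_gauge.
    + apply tail_expands_all with (fun n => (f n * u n)%C); [exact Hs|exact He| |exact Ee].
      apply expands_mult; [exact z_tends0| |exact HN].
      apply expands_pred; [exact z_tends0|]. apply leads_expands with f0, Hf.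
  - apply filter_forall. intros n.
    assert (Hz := gauge_neq0 m n). fold z in Hz.
    assert (Hzs := Cpow_nz _ s Hz).
    replace (z n * (z n ^ (s - 1) * (e n / z n ^ s)))%C
      with (z n ^ S (s - 1) * (e n / z n ^ s))%C by (simpl; ring).
    replace (S (s - 1)) with s by lia. unfold e. field. exact Hzs. }
assert (Hall : forall N, leads z N l u).
{ intros N. apply Hul. induction N as [|N IH].
  - now apply tends_bounded with l.
  - apply leads_expands with l. now apply Hul. }
split; [exact Hall|]. intros N.
apply (tail_leads N s e (fun n => (f n * u n)%C));
  [apply tail_expands_all|exact Hs|exact He| |exact Ee].
now apply leads_mult.
Qed.

End Summation.

(** * Coefficients and real functions with a prescribed expansion *)

Fixpoint trunc (c : nat -> C) (N : nat) (x : C) : C :=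
  match N with
  | O => RtoC 0
  | S N' => (trunc c N' x + c N' * x ^ N')%C
  end.

Lemma trunc_S c N x :
  trunc c (S N) x = (c 0%nat + x * trunc (fun i => c (S i)) N x)%C.
Proof.
induction N as [|N IH]; [simpl; ring|].
change (trunc c (S (S N)) x) with (trunc c (S N) x + c (S N) * x ^ S N)%C.
rewrite IH. simpl. ring.
Qed.

Lemma trunc_ext c d N x :
  (forall i, (i < N)%nat -> c i = d i) -> trunc c N x = trunc d N x.
Proof.
intros H. induction N as [|N IH]; [easy|]. simpl.
rewrite IH, (H N); auto with arith.
Qed.

Lemma sum_n_trunc (F c : nat -> C) (y x : C) (N : nat) :
  (forall i, F i = (y * (c i * x ^ i))%C) -> (1 <= N)%nat ->
  sum_n F (N - 1) = (y * trunc c N x)%C.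
Proof.
intros HF HN. destruct N as [|N]; [lia|].
rewrite Nat.sub_succ, Nat.sub_0_r. clear HN.
induction N as [|N IH].
- rewrite sum_O, HF. simpl. ring.
- rewrite sum_Sn, IH, HF.
  change (plus ?p ?q) with (Cplus p q). simpl. ring.
Qed.

Definition approx (z : nat -> C) (N : nat) (c : nat -> C) (a : nat -> C) : Prop :=
  exists K : R,
    eventually (fun n => Cmod (a n - trunc c N (z n)) <= K * Cmod (z n) ^ N).

Lemma approx_shift z N c a :
  (forall n, z n <> RtoC 0) -> approx z (S N) c a ->
  approx z N (fun i => c (S i)) (fun n => ((a n - c 0%nat) / z n)%C).
Proof.
intros Hz [K HK]. exists K. generalize HK. apply filter_imp. intros n Hn.
assert (Hp : 0 < Cmod (z n)) by now apply Cmod_gt_0.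
apply Rmult_le_reg_l with (Cmod (z n)); [exact Hp|].
rewrite <- Cmod_mult.
replace (z n * ((a n - c 0%nat) / z n - trunc (fun i => c (S i)) N (z n)))%C
  with (a n - trunc c (S N) (z n))%C by (rewrite trunc_S; field; apply Hz).
eapply Rle_trans; [exact Hn|]. right. simpl. ring.
Qed.

Lemma approx_expands z N c a :
  (forall n, z n <> RtoC 0) -> approx z N c a -> expands z N a.
Proof.
intros Hz. revert c a. induction N as [|N IH]; intros c a H.
- destruct H as [K HK]. exists K. generalize HK. apply filter_imp.
  intros n. simpl. replace (a n - 0)%C with (a n) by ring. lra.
- exists (c 0%nat), (fun n => ((a n - c 0%nat) / z n)%C). split.
  + apply IH with (fun i => c (S i)). now apply approx_shift.
  + apply filter_forall. intros n. field. apply Hz.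
Qed.

Lemma approx_leads z N c a :
  (forall n, z n <> RtoC 0) -> approx z (S N) c a -> leads z N (c 0%nat) a.
Proof.
intros Hz H. exists (fun n => ((a n - c 0%nat) / z n)%C). split.
- apply approx_expands with (fun i => c (S i)); [exact Hz|].
  now apply approx_shift.
- apply filter_forall. intros n. field. apply Hz.
Qed.

(** The constant terms for different orders agree, being the limit of the
    sequence; hence one may strip the constant term, divide by [z] and repeat,
    which produces all the coefficients. *)
Lemma expands_coefficients z (a : nat -> C) (l : C) :
  (forall n, z n <> RtoC 0) -> tends z (RtoC 0) ->
  (forall N, leads z N l a) ->
  exists c : nat -> C, c 0%nat = l /\ forall N, approx z N c a.
Proof.
intros Hz Hz0 Hl.
assert (Hex : forall b : nat -> C, exists l' : C,
          (forall N, expands z N b) -> forall N, leads z N l' b).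
{ intros b. destruct (classic (forall N, expands z N b)) as [Hb|Hb].
  - destruct (Hb 1%nat) as [l' Hl']. exists l'. intros _ N.
    apply leads_expands_tends; [exact Hz0|]. split; [apply Hb|].
    now apply (leads_tends z Hz0 0).
  - exists (RtoC 0). now intros H. }
destruct (functional_choice _ Hex) as [L HL].
(* [L b] is the limit of [b], and [T] strips it off. *)
set (T := fun (b : nat -> C) n => ((b n - L b) / z n)%C).
assert (HT : forall b, (forall N, expands z N b) -> forall N, expands z N (T b)).
{ intros b Hb N. destruct (HL b Hb N) as [b' [Hb' E]].
  apply expands_ext with b'; [|exact Hb'].
  generalize E. apply filter_imp. intros n Hn. unfold T. rewrite Hn.
  field. apply Hz. }
assert (Ha : forall N, expands z N a).
{ intros N. apply expands_pred; [exact Hz0|]. apply leads_expands with l, Hl. }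
set (B := fun i => Nat.iter i T a).
assert (HB : forall i N, expands z N (B i)).
{ induction i as [|i IH]; [exact Ha|]. now apply HT. }
exists (fun i => L (B i)). split.
- apply (tends_unique a).
  + apply (leads_tends z Hz0 0). apply (HL a Ha).
  + apply (leads_tends z Hz0 0), Hl.
- intros N.
  assert (Hrem : forall n,
    a n = (trunc (fun i => L (B i)) N (z n) + z n ^ N * B N n)%C).
  { intros n. induction N as [|N IH]; [simpl; ring|].
    rewrite IH at 1. simpl trunc. change (B (S N)) with (T (B N)).
    unfold T. simpl. field. apply Hz. }
  destruct (HB N 0%nat) as [K HK]. exists K. generalize HK.
  apply filter_imp. intros n Hn. rewrite (Hrem n) at 1.
  replace (trunc (fun i => L (B i)) N (z n) + z n ^ N * B N n
             - trunc (fun i => L (B i)) N (z n))%C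
    with (z n ^ N * B N n)%C by ring.
  rewrite Cmod_mult, Cmod_pow, Rmult_comm.
  apply Rmult_le_compat_r; [apply pow_le, Cmod_ge_0|exact Hn].
Qed.

(** Every sequence [c], of any growth, is the sequence of coefficients of some
    function as [x] tends to 0 from above.  The [i]-th term is switched on only
    once [x <= 1 / (2^i |c_i|)]: each term is present for small [x], while
    [|c_i| x^i <= 2^(-i) x^(i-1)] whenever it is present, so that the tail from
    [N + 1] on is at most [x^N].  Cutting the sum at about [1/x] terms avoids an
    infinite series. *)
Lemma borel_ritt (c : nat -> C) :
  exists H : R -> C, forall N : nat, exists K d : R, 0 < d /\
    forall x : R, 0 < x < d -> Cmod (H x - trunc c N (RtoC x)) <= K * x ^ N.
Proof.
set (b := fun (x : R) (i : nat) =>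
  if Rle_dec (Cmod (c i) * 2 ^ i * x) 1 then c i else RtoC 0).
exists (fun x => trunc (b x) (Z.to_nat (up (/ x))) (RtoC x)).
intros N.
assert (Hd : exists d, 0 < d /\
          forall x, 0 < x < d -> forall i, (i < S N)%nat -> b x i = c i).
{ generalize (S N) as M. induction M as [|M [d [Hd0 Hd]]].
  - exists 1. split; [lra|]. intros x _ i Hi; lia.
  - set (w := Cmod (c M) * 2 ^ M).
    assert (Hw : 0 <= w).
    { apply Rmult_le_pos; [apply Cmod_ge_0|]. apply pow_le; lra. }
    assert (Hw1 : 0 < / (w + 1)) by (apply Rinv_0_lt_compat; lra).
    exists (Rmin d (/ (w + 1))). split; [now apply Rmin_glb_lt|].
    intros x [Hx0 Hx] i Hi.
    assert (Hxd := Rlt_le_trans _ _ _ Hx (Rmin_l _ _)).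
    assert (Hxw := Rlt_le_trans _ _ _ Hx (Rmin_r _ _)).
    destruct (Nat.eq_dec i M) as [->|Hne]; [|apply Hd; [lra|lia]].
    unfold b. destruct (Rle_dec (Cmod (c M) * 2 ^ M * x) 1) as [_|Hn]; [easy|].
    exfalso. apply Hn. fold w.
    apply Rmult_le_reg_r with (/ (w + 1)); [exact Hw1|].
    rewrite Rmult_1_l. apply Rle_trans with (w * / (w + 1) * / (w + 1)).
    + replace (w * x * / (w + 1)) with (w * / (w + 1) * x) by ring.
      apply Rmult_le_compat_l; [apply Rmult_le_pos; lra|lra].
    + rewrite <- (Rmult_1_l (/ (w + 1))) at 3.
      apply Rmult_le_compat_r; [lra|].
      apply Rmult_le_reg_r with (w + 1); [lra|].
      rewrite Rmult_assoc, Rinv_l; lra. }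
destruct Hd as [d [Hd0 Hd]].
assert (HSN : 0 < INR (S N)) by (apply lt_0_INR; lia).
(* [Cmod (c N)] accounts for the term of index [N], and 1 for the later ones. *)
exists (Cmod (c N) + 1), (Rmin (Rmin d 1) (/ INR (S N))). split.
{ repeat apply Rmin_glb_lt; try lra. now apply Rinv_0_lt_compat. }
intros x [Hx0 Hx].
assert (Hx1 := Rlt_le_trans _ _ _ Hx (Rmin_l _ _)).
assert (Hxd := Rlt_le_trans _ _ _ Hx1 (Rmin_l _ _)).
apply Rlt_le_trans with (2 := Rmin_r _ _) in Hx1.
assert (HxN := Rlt_le_trans _ _ _ Hx (Rmin_r _ _)).
assert (HxNp : 0 < x ^ N) by now apply pow_lt.
assert (Hpow1 : forall (y : R) j, 0 <= y <= 1 -> y ^ j <= 1).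
{ intros y j Hy. rewrite <- (pow1 j). now apply pow_incr. }
assert (Htail : forall j,
  Cmod (trunc (b x) (S N + j) (RtoC x) - trunc (b x) (S N) (RtoC x))
    <= x ^ N * (1 - (1 / 2) ^ j)).
{ induction j as [|j IH].
  - rewrite Nat.add_0_r. simpl pow at 2.
    replace (trunc (b x) (S N) (RtoC x) - trunc (b x) (S N) (RtoC x))%C
      with (RtoC 0) by ring. rewrite Cmod_0. lra.
  - replace (S N + S j)%nat with (S (S N + j)) by lia.
    set (i := (S N + j)%nat) in *.
    change (trunc (b x) (S i) (RtoC x))
      with (trunc (b x) i (RtoC x) + b x i * RtoC x ^ i)%C.
    replace (trunc (b x) i (RtoC x) + b x i * RtoC x ^ i
               - trunc (b x) (S N) (RtoC x))%C
      with ((trunc (b x) i (RtoC x) - trunc (b x) (S N) (RtoC x))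
               + b x i * RtoC x ^ i)%C by ring.
    eapply Rle_trans; [apply Cmod_triangle|].
    assert (Hterm : Cmod (b x i * RtoC x ^ i) <= x ^ N * (1 / 2) ^ S j).
    { rewrite Cmod_mult, Cmod_pow, Cmod_R, Rabs_pos_eq by lra.
      assert (Hb : Cmod (b x i) * x <= (1 / 2) ^ i).
      { assert (H2i : 0 < 2 ^ i) by (apply pow_lt; lra).
        replace ((1 / 2) ^ i) with (/ 2 ^ i)
          by (rewrite <- pow_inv; f_equal; lra).
        unfold b. destruct (Rle_dec (Cmod (c i) * 2 ^ i * x) 1) as [H|_].
        - apply Rmult_le_reg_r with (2 ^ i); [exact H2i|].
          rewrite Rinv_l by lra. lra.
        - rewrite Cmod_0, Rmult_0_l. left; now apply Rinv_0_lt_compat. }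
      assert (Hi : x ^ i = x * (x ^ N * x ^ j)).
      { unfold i. rewrite <- pow_add. reflexivity. }
      rewrite Hi, <- Rmult_assoc.
      assert (Hhalf : (1 / 2) ^ i <= (1 / 2) ^ S j).
      { unfold i. replace (S N + j)%nat with (S j + N)%nat by lia.
        rewrite pow_add. rewrite <- (Rmult_1_r ((1 / 2) ^ S j)) at 2.
        apply Rmult_le_compat_l; [apply pow_le; lra|].
        apply Hpow1; lra. }
      assert (Hxj : 0 <= x ^ j <= 1).
      { split; [apply pow_le; lra|]. apply Hpow1; lra. }
      rewrite (Rmult_comm (x ^ N) ((1 / 2) ^ S j)).
      apply Rmult_le_compat;
        [apply Rmult_le_pos; [apply Cmod_ge_0|lra]
        |apply Rmult_le_pos; lra|lra|].
      rewrite <- (Rmult_1_r (x ^ N)) at 2.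
      apply Rmult_le_compat_l; lra. }
    eapply Rle_trans; [apply Rplus_le_compat; [exact IH|exact Hterm]|].
    right. simpl pow. field. }
assert (HM : (S N <= Z.to_nat (up (/ x)))%nat).
{ assert (H1 : INR (S N) < / x).
  { rewrite <- (Rinv_inv (INR (S N))). apply Rinv_lt_contravar; [|exact HxN].
    apply Rmult_lt_0_compat; [exact Hx0|]. now apply Rinv_0_lt_compat. }
  destruct (archimed (/ x)) as [H2 _].
  assert (H3 : (Z.of_nat (S N) < up (/ x))%Z).
  { apply lt_IZR. rewrite <- INR_IZR_INZ. lra. }
  lia. }
destruct (Nat.le_exists_sub _ _ HM) as [j [Hj _]].
rewrite Hj, Nat.add_comm.
replace (trunc (b x) (S N + j) (RtoC x) - trunc c N (RtoC x))%C
  with ((trunc (b x) (S N + j) (RtoC x) - trunc (b x) (S N) (RtoC x))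
          + c N * RtoC x ^ N)%C.
- eapply Rle_trans; [apply Cmod_triangle|].
  rewrite Cmod_mult, Cmod_pow, Cmod_R, (Rabs_pos_eq x) by lra.
  generalize (Htail j). assert (0 < (1 / 2) ^ j) by (apply pow_lt; lra).
  assert (0 < x ^ N * (1 / 2) ^ j) by now apply Rmult_lt_0_compat.
  lra.
- rewrite (trunc_ext (b x) c (S N)).
  + simpl. ring.
  + apply Hd. lra.
Qed.


(** * Expansions of functions and of their values at the integers *)

Lemma xpow_rho (m s i : nat) (x : R) :
  xpow x (RtoC (- INR s / INR m) - RtoC (INR i / INR m))
    = (RtoC (rho m x) ^ (s + i))%C.
Proof.
rewrite <- RtoC_minus, xpow_RtoC, <- RtoC_pow, rho_pow, plus_INR.
f_equal. f_equal. unfold Rdiv. ring.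
Qed.

(** Dividing by [z^t] turns the powers [x^(-t/m - i/m)] into [z^i]. *)
Lemma has_expansion_sample (m t : nat) (w : R -> C) (c : nat -> C) :
  has_expansion (RtoC (- INR t / INR m)) m w c ->
  forall N, approx (gauge m) (S N) c (fun n => (w (INR n) / gauge m n ^ t)%C).
Proof.
intros Hw N. destruct (Hw (S N) ltac:(lia)) as [K [X HX]].
exists K. generalize (eventually_INR_gt X). apply filter_imp. intros n Hn.
specialize (HX _ Hn). cbv beta in HX.
rewrite (sum_n_trunc _ c (gauge m n ^ t)%C (gauge m n)) in HX; [|intros i|lia].
- rewrite xpow_rho in HX. fold (gauge m n) in HX.
  assert (Hz := gauge_neq0 m n). assert (Hzt := Cpow_nz _ t Hz).
  assert (Hp : 0 < Cmod (gauge m n ^ t)) by now apply Cmod_gt_0.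
  apply Rmult_le_reg_l with (Cmod (gauge m n ^ t)); [exact Hp|].
  rewrite <- Cmod_mult.
  replace (gauge m n ^ t * (w (INR n) / gauge m n ^ t - trunc c (S N) (gauge m n)))%C
    with (w (INR n) - gauge m n ^ t * trunc c (S N) (gauge m n))%C
    by (field; exact Hzt).
  eapply Rle_trans; [exact HX|].
  rewrite Cpow_add_r, Cmod_mult, (Cmod_pow _ (S N)). right; ring.
- rewrite xpow_rho. fold (gauge m n). rewrite Cpow_add_r. ring.
Qed.

(** A Borel-Ritt function for [c] is overwritten at the integers by [a]; the two
    error bounds combine. *)
Lemma has_expansion_interpolate (m : nat) (a c : nat -> C) :
  (1 <= m)%nat ->
  (forall N, approx (gauge m) N c a) ->
  exists g : R -> C,
    has_expansion (RtoC 0) m g c /\ forall n, g (INR n) = a n.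
Proof.
intros Hm Ha. destruct (borel_ritt c) as [H HH].
assert (Hex : forall x : R, exists y : C,
  (forall n, x = INR n -> y = a n) /\
  ((forall n, x <> INR n) -> y = H (rho m x))).
{ intros x. destruct (classic (exists n, x = INR n)) as [[n Hn]|Hn].
  - exists (a n). split.
    + intros n' Hn'. f_equal. apply INR_eq. now rewrite <- Hn.
    + intros H'. now destruct (H' n).
  - exists (H (rho m x)). split; [|easy].
    intros n E. destruct Hn. now exists n. }
destruct (functional_choice _ Hex) as [g Hg].
exists g. split; [|intros n; now apply (proj1 (Hg (INR n)))].
intros N HN.
destruct (Ha N) as [K1 [n1 H1]].
destruct (HH N) as [K2 [d [Hd H2]]].
destruct (rho_small m d Hm Hd) as [X [_ HX]].
exists (Rmax K1 K2), (Rmax X (INR n1)). intros x Hx.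
assert (Hx1 := Rle_lt_trans _ _ _ (Rmax_l _ _) Hx).
assert (Hx2 := Rle_lt_trans _ _ _ (Rmax_r _ _) Hx).
(* [xpow_rho] expects the exponent in the form [- s / m]. *)
assert (E0 : RtoC 0 = RtoC (- INR 0 / INR m)).
{ f_equal. simpl. unfold Rdiv. ring. }
rewrite (sum_n_trunc _ c (RtoC 1) (RtoC (rho m x))); [|intros i|exact HN].
2:{ rewrite E0, xpow_rho. simpl. ring. }
rewrite E0, xpow_rho. simpl Nat.add.
rewrite Cmult_1_l, Cmod_pow.
assert (HP : 0 < Cmod (RtoC (rho m x)) ^ N).
{ apply pow_lt. rewrite Cmod_R, Rabs_pos_eq by (left; apply rho_pos).
  apply rho_pos. }
destruct (classic (exists n, x = INR n)) as [[n ->]|Hn].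
- rewrite (proj1 (Hg (INR n)) n eq_refl).
  apply INR_lt in Hx2.
  eapply Rle_trans; [exact (H1 n ltac:(lia))|].
  apply Rmult_le_compat_r; [lra|apply Rmax_l].
- rewrite (proj2 (Hg x)) by (intros n E; apply Hn; now exists n).
  assert (Hr := rho_pos m x).
  eapply Rle_trans; [exact (H2 (rho m x) (conj Hr (HX x Hx1)))|].
  rewrite Cmod_R, Rabs_pos_eq in HP |- * by lra.
  apply Rmult_le_compat_r; [lra|apply Rmax_r].
Qed.

Theorem theorem6p1 :
  forall (m t : nat) (w : R -> C) (v A a : nat -> C) (Sval : C),
    (1 <= m)%nat ->
    (m + 1 <= t)%nat ->
    A0_strictly (RtoC (- INR t / INR m)) m w ->
    (forall n : nat, (1 <= n)%nat -> v n = w (INR n)) ->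
    inf_prod_converges_to (fun n => (RtoC 1 + v n)%C) Sval ->
    A 0%nat = RtoC 0 ->
    (forall n : nat, (1 <= n)%nat ->
       A n = partial_prod (fun k => (RtoC 1 + v k)%C) n) ->
    (forall n : nat, (1 <= n)%nat -> a n = (A n - A (n - 1)%nat)%C) ->
    (exists g : R -> C,
       A0_strictly (RtoC 0) m g /\
       eventually (fun n : nat =>
         A (n - 1)%nat = (Sval + RtoC (INR n) * a n * g (INR n))%C)) /\
    (exists alpha : C,
       alpha <> RtoC 0 /\
       seq_sim (fun n => (A n - Sval)%C) alpha
         (fun n => RtoC (Rpower (INR n) (1 - INR t / INR m)))).
Proof.
intros m t w v A a Sval Hm Ht [c [Hw Hc0]] Hv [Hlim HS] _ HA Ha.
set (s := (t - m)%nat).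
assert (Hs : (1 <= s)%nat) by (unfold s; lia).
assert (Hts : t = (m + s)%nat) by (unfold s; lia).
assert (HmR : 0 < INR m) by (apply lt_0_INR; lia).
assert (HsR : 0 < INR s) by (apply lt_0_INR; lia).
set (z := gauge m).
assert (Hz : forall n, z n <> RtoC 0) by apply gauge_neq0.
assert (Hz0 : tends z (RtoC 0)) by now apply gauge_tends0.
set (f := fun n => (w (INR n) / z n ^ t)%C).
assert (Hf : forall N, leads z N (c 0%nat) f).
{ intros N. apply approx_leads; [exact Hz|]. now apply has_expansion_sample. }
set (u := fun n => A (n - 1)%nat).
assert (Hvf : forall n, (1 <= n)%nat -> v n = (z n ^ t * f n)%C).
{ intros n Hn. rewrite Hv by exact Hn. unfold f. field. now apply Cpow_nz. }
assert (Hu : tends u Sval).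
{ apply tends_filterlim in Hlim. intros eps Heps.
  destruct (Hlim eps Heps) as [n0 H0]. exists (S (S n0)). intros n Hn.
  unfold u. rewrite HA by lia. apply H0. lia. }
assert (Hge2 : eventually (fun n => (2 <= n)%nat)) by (exists 2%nat; auto).
assert (Hau : eventually (fun n => a n = (z n ^ t * (f n * u n))%C)).
{ generalize Hge2. apply filter_imp. intros n Hn.
  rewrite Ha by lia. unfold u. rewrite !HA by lia.
  destruct n as [|n]; [lia|]. rewrite Nat.sub_succ, Nat.sub_0_r.
  simpl partial_prod. rewrite Hvf by lia. ring. }
assert (Hrec : eventually (fun n =>
          (u (S n) - u n = z n ^ (m + s) * (f n * u n))%C)).
{ generalize (filter_and _ _ Hau Hge2). apply filter_imp. intros n [H Hn].
  rewrite <- Hts, <- H, Ha by lia. unfold u.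
  now rewrite Nat.sub_succ, Nat.sub_0_r. }
destruct (recurrence_leads m Hm s u f Sval (c 0%nat) Hs Hu Hf Hrec)
  as [Hul HR].
fold z in Hul, HR.
set (R' := fun n => ((u n - Sval) / z n ^ s)%C) in HR.
set (alpha := (- (c 0%nat * Sval * RtoC (INR m / INR s)))%C) in HR.
assert (Hcs : (c 0%nat * Sval)%C <> RtoC 0) by now apply Cmult_neq_0.
assert (Hms : RtoC (INR m / INR s) <> RtoC 0).
{ intros E. apply RtoC_inj in E. generalize (Rdiv_lt_0_compat _ _ HmR HsR). lra. }
assert (Halpha : alpha <> RtoC 0).
{ intros E. apply (Cmult_neq_0 _ _ Hcs Hms).
  replace (c 0%nat * Sval * RtoC (INR m / INR s))%C with (- alpha)%C
    by (unfold alpha; ring).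
  rewrite E. ring. }
assert (Hfu : forall N, leads z N (c 0%nat * Sval)%C (fun n => (f n * u n)%C)).
{ intros N. now apply leads_mult. }
(* [G n = (u n - Sval) / (n a_n)], because [n a_n = z n ^ s * (f n * u n)]. *)
set (G := fun n => (R' n * / (f n * u n))%C).
assert (HG : forall N, leads z N (alpha * / (c 0%nat * Sval))%C G).
{ intros N. apply leads_mult; [exact Hz0|apply HR|]. now apply leads_inv. }
split.
- destruct (expands_coefficients z G _ Hz Hz0 HG) as [d [Hd0 Hd]].
  destruct (has_expansion_interpolate m G d Hm Hd) as [g [Hg HgG]].
  exists g. split.
  + exists d. split; [exact Hg|]. rewrite Hd0.
    apply Cmult_neq_0; [exact Halpha|].
    intros E. apply C1_nz.
    rewrite <- (Cinv_r (c 0%nat * Sval)%C Hcs), E. ring.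
  + assert (Hfu0 : eventually (fun n => (f n * u n)%C <> RtoC 0)).
    { apply eventually_neq0 with (Cmod (c 0%nat * Sval) / 2).
      - apply Cmod_gt_0 in Hcs. lra.
      - apply tends_bounded_away; [exact Hcs|].
        exact (leads_tends z Hz0 _ _ _ (Hfu 0%nat)). }
    generalize (filter_and _ _ Hau (filter_and _ _ Hfu0 Hge2)).
    apply filter_imp. intros n [H1 [H2 H3]].
    rewrite HgG, H1. unfold G, R'. fold (u n).
    assert (Hn := gauge_pow_m m Hm n ltac:(lia)). fold z in Hn.
    assert (Hzs := Cpow_nz _ s (Hz n)).
    rewrite Hts, Cpow_add_r.
    replace (RtoC (INR n) * (z n ^ m * z n ^ s * (f n * u n))
               * ((u n - Sval) / z n ^ s * / (f n * u n)))%C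
      with ((RtoC (INR n) * z n ^ m) * (u n - Sval))%C.
    * rewrite Hn. ring.
    * field. repeat split; try assumption; intros E; apply H2; rewrite E; ring.
- exists alpha. split; [exact Halpha|].
  unfold seq_sim. apply tends_filterlim.
  (* [A n = u n + a n], and [a n] is smaller than [z n ^ s] by the factor
     [z n ^ m], so it leaves the limit unchanged. *)
  assert (Hlast : leads z 0 (alpha + 0 * (c 0%nat * Sval))%C
            (fun n => (R' n + z n ^ m * (f n * u n))%C)).
  { apply leads_plus; [apply HR|].
    apply leads_mult; [exact Hz0| |apply Hfu]. now apply leads_gauge_pow. }
  assert (Hlim' := leads_tends z Hz0 _ _ _ Hlast).
  replace (alpha + 0 * (c 0%nat * Sval))%C with alpha in Hlim' by ring.
  intros eps Heps.
  generalize (filter_and _ _ (Hlim' eps Heps) (filter_and _ _ Hrec Hge2)).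
  apply filter_imp. intros n [H1 [H2 H3]].
  replace (Rpower (INR n) (1 - INR t / INR m)) with (rho m (INR n) ^ s).
  + rewrite RtoC_pow. fold (gauge m n). fold z.
    replace ((A n - Sval) / z n ^ s)%C with (R' n + z n ^ m * (f n * u n))%C;
      [exact H1|].
    replace (A n) with (u n + (u (S n) - u n))%C
      by (unfold u; rewrite Nat.sub_succ, Nat.sub_0_r; ring).
    rewrite H2, Cpow_add_r. unfold R'. field. now apply Cpow_nz.
  + rewrite rho_pow, Hts, plus_INR. f_equal. field. lra.
Qed.
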